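(* There exists a uniquely divisible metabelian group $G$ with the following property: for all finite words $w$ in the alphabet $\{X,A\}$, if the equation $P_w(x^2,y^2)=0$ has a solution $(x_p,y_p)\in(\mathbb{Z}/p\mathbb{Z})^*\times(\mathbb{Z}/p\mathbb{Z})^*$ for all but finitely many primes $p$, then there exist elements $A,B,B'\in G$ for which the word equation $w(X,A)=B$ has no solution $X\in G$, and the word equation $w(X,A)=B'$ has at least two solutions $X\in G$.
   Context: A group $G$ is uniquely divisible if for every $g\in G$ and each positive integer $m$ there exists a unique $h\in G$ with $h^m=g$. A group is metabelian if its commutator subgroup is abelian. For a finite word $w$ in the alphabet $\{X,A\}$ and elements $g,a$ of a group, $w(g,a)$ denotes the group element obtained by substituting $g$ for the letter $X$ and $a$ for the letter $A$. Writing $w=A^{a_0}XA^{a_1}X\cdots A^{a_{n-1}}XA^{a_n}$ with integers $n\ge 0$ and $a_i\ge 0$, the word polynomial of $w$ is $P_w(x,y)=\sum_{k=0}^{n-1}x^k y^{a_0+\cdots+a_k}\in\mathbb{Z}[x,y]$ (the empty sum being $0$). $(\mathbb{Z}/p\mathbb{Z})^*$ is the set of nonzero elements of $\mathbb{Z}/p\mathbb{Z}$, and $P_w(x^2,y^2)=0$ is understood in $\mathbb{Z}/p\mathbb{Z}$. *)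

(* Defs.v *)
From HB Require Import structures.
From mathcomp Require Import all_boot all_order all_fingroup all_algebra.

Set Implicit Arguments.
Unset Strict Implicit.
Unset Printing Implicit Defensive.

Import GRing.Theory.

Definition uniquely_divisible (G : groupType) : Prop :=
  forall (g : G) (m : nat), 0 < m -> exists! h : G, (h ^+ m)%g = g.

(* The subgroup generated by all commutators; the subgroup operations of
   [fingroup] are only available for finite groups. *)
Inductive commutator_subgroup (G : groupType) : G -> Prop :=
| CommSubgComm (x y : G) : commutator_subgroup [~ x, y]%g
| CommSubg1 : commutator_subgroup (1 : G)%g
| CommSubgM (u v : G) :
    commutator_subgroup u -> commutator_subgroup v ->
    commutator_subgroup (u * v)%g
| CommSubgV (u : G) : commutator_subgroup u -> commutator_subgroup (u^-1)%g.

Definition metabelian (G : groupType) : Prop :=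
  forall u v : G,
    commutator_subgroup u -> commutator_subgroup v -> commute u v.

Inductive letter : Set := LX | LA.

Definition word := seq letter.

Definition word_eval (G : groupType) (w : word) (g a : G) : G :=
  (\prod_(c <- w) (if c is LX then g else a))%g.

(* [A_exponents w] is [:: a_0; ...; a_n] when
   w = A^{a_0} X A^{a_1} X ... A^{a_{n-1}} X A^{a_n};
   see [A_exponentsP] and [A_exponents_blocks]. *)
Fixpoint A_exponents (w : word) : seq nat :=
  match w with
  | [::] => [:: 0]
  | LA :: w' => incr_nth (A_exponents w') 0
  | LX :: w' => 0 :: A_exponents w'
  end.

Definition word_of_blocks (a0 : nat) (s : seq nat) : word :=
  nseq a0 LA ++ flatten [seq LX :: nseq a LA | a <- s].

Lemma A_exponents_blocks (a0 : nat) (s : seq nat) :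
  A_exponents (word_of_blocks a0 s) = a0 :: s.
Proof.
elim: s a0 => [|a s IHs] a0; elim: a0 => [|a0 IHa] //=.
- by rewrite -/(word_of_blocks a0 [::]) IHa.
- by rewrite -/(word_of_blocks a s) IHs.
- by rewrite -/(word_of_blocks a0 (a :: s)) IHa.
Qed.

Lemma A_exponentsP (w : word) :
  w = word_of_blocks (head 0 (A_exponents w)) (behead (A_exponents w)).
Proof.
suff [a0 [s ->]] : exists a0 s, w = word_of_blocks a0 s.
  by rewrite A_exponents_blocks.
elim: w => [|[] w [a0 [s ->]]]; first by exists 0, [::].
  by exists 0, (a0 :: s).
by exists a0.+1, s.
Qed.

Local Open Scope ring_scope.

(* Here x is the outer variable 'X and y is 'Y (the coefficient variable), so
   that [u.[x, y]] of [polyXY] evaluates in the order (x, y). *)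
Definition word_poly (w : word) : {poly {poly int}} :=
  let a := A_exponents w in
  \sum_(k < (size a).-1) 'X ^+ k * 'Y ^+ (\sum_(i < k.+1) nth 0%N a i)%N.

Definition word_poly_Fp (p : nat) (w : word) : {poly {poly 'F_p}} :=
  map_poly (map_poly intr) (word_poly w).

(* Main.v *)
Require Import Defs.
From HB Require Import structures.
From mathcomp Require Import all_boot all_order all_fingroup all_algebra.
From mathcomp Require Import all_field boolp zify ring.

(** Over a field F_p with p odd, the affine maps z |-> h z + v with h a nonzero
square form a metabelian group of exponent dividing p (p - 1) / 2.  For
X = (g, t) and A = (h, 0) the translation part of w(X, A) is t P_w(g, h)
([shift_word_eval]).  If P_w(g, h) = 0, then t disappears from w(X, A), so that
t = 0 and t = 1 solve the same equation.  On the other hand, no X satisfies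
w(X, A) = B when B has the linear part of w((g, 0), A) and translation part 1:
let n be the number of letters X in w; if n is prime to (p - 1) / 2, raising to
the power n is injective on the squares, so that the linear part of such an X
would be g, and the translation part of w(X, A) would be 0; if n = 0, then
P_w = 0 and the translation part of w(X, A) is always 0.

To turn these finite groups into a uniquely divisible one, let p run through a
sequence of primes such that every m > 0 is eventually prime to
p (p - 1) / 2, and take sequences of elements modulo eventual equality
([germ_uniquely_divisible]).  Equations in this reduced product are equations
that hold eventually, and a condition on all but finitely many primes is a
condition on almost all terms of the sequence.

The primes come from [primes_congr_pred1]: there are arbitrarily large primes
p = -1 modulo any N; for N = 4 n! they make (p - 1) / 2 prime to n!.  Its proof
is of Euclidean type.  Let V be the N-th cyclotomic form, made homogeneous,
at the Gaussian integer a + bi and its conjugate; V is an integer.  When a prime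
p = 3 modulo 4 divides V but neither b nor N, the Frobenius of a field of
characteristic p exchanges a + bi and a - bi.  Their quotient x satisfies
x ^ (p + 1) = 1 and has order N, whence p = -1 modulo N
([dvdn_Frobenius_order]).  Such a p exists as soon as some integer equal to V up
to sign is 3 modulo 4.  Congruences on a and b alone make V equal to Phi_N(1)
modulo 4, which is 1 or -1 if 6 divides N ([Cyclotomic1_unit]), and so they
would give the wrong residue if Phi_N(1) V were positive.  But V has a
factorization Phi_N(1) prod_r (a - b r) with distinct real r
([cyclotomic_form_real_roots]): choosing a / b between the two largest r makes
Phi_N(1) V negative, and its absolute value 3 modulo 4. *)

Set Implicit Arguments.
Unset Strict Implicit.
Unset Printing Implicit Defensive.

Import Order.TTheory GRing.Theory Num.Theory.

(** * Reduced products of a sequence of groups *)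

Local Open Scope quotient_scope.

Section ReducedProduct.
Variable T : nat -> groupType.
Local Notation dseq := (forall n, T n).

Definition eventually (P : nat -> Prop) := exists N, forall n, N <= n -> P n.

Lemma eventually_and P Q :
  eventually P -> eventually Q -> eventually (fun n => P n /\ Q n).
Proof.
move=> [N PN] [M QM]; exists (maxn N M) => n; rewrite geq_max => /andP[/PN Pn /QM Qn].
by [].
Qed.

Lemma eventually_mono (P Q : nat -> Prop) :
  (forall n, P n -> Q n) -> eventually P -> eventually Q.
Proof. by move=> PQ [N PN]; exists N => n /PN/PQ. Qed.

Definition germ_eq (f g : dseq) : bool := `[< eventually (fun n => f n = g n) >].

Lemma germ_eq_equiv : equiv_class_of germ_eq.
Proof.
split=> [f | f g | g f h].
- by apply/asboolP; exists 0.
- by apply: asbool_equiv_eq; split; apply: eventually_mono => n ->.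
move=> /asboolP fg /asboolP gh; apply/asboolP.
by apply: eventually_mono (eventually_and fg gh) => n [-> ->].
Qed.

Canonical germ_eq_canonical := EquivRelPack germ_eq_equiv.

Definition germ := {eq_quot germ_eq}.
HB.instance Definition _ := Choice.on germ.
Definition to_germ (f : dseq) : germ := \pi_germ f.

Lemma to_germP f g : to_germ f = to_germ g <-> eventually (fun n => f n = g n).
Proof.
split=> [/eqmodP/asboolP // | fg].
by apply/eqmodP/asboolP.
Qed.

Definition germ_repr (x : germ) : dseq := generic_quotient.repr x.

Lemma to_germK (x : germ) : to_germ (germ_repr x) = x.
Proof. exact: reprK. Qed.

Lemma repr_to_germ (f : dseq) : eventually (fun n => germ_repr (to_germ f) n = f n).
Proof. by apply/to_germP; rewrite to_germK. Qed.

Definition germ_mul (x y : germ) : germ :=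
  to_germ (fun n => germ_repr x n * germ_repr y n)%g.
Definition germ_inv (x : germ) : germ := to_germ (fun n => (germ_repr x n)^-1)%g.
Definition germ_one : germ := to_germ (fun n => 1%g).

Lemma germ_mulE f g : germ_mul (to_germ f) (to_germ g) = to_germ (fun n => f n * g n)%g.
Proof.
apply/to_germP; apply: eventually_mono (eventually_and (repr_to_germ f) (repr_to_germ g)).
by move=> n [-> ->].
Qed.

Lemma germ_invE f : germ_inv (to_germ f) = to_germ (fun n => (f n)^-1)%g.
Proof. by apply/to_germP; apply: eventually_mono (repr_to_germ f) => n ->. Qed.

Lemma germ_ind (P : germ -> Prop) : (forall f, P (to_germ f)) -> forall x, P x.
Proof. by move=> Pf x; rewrite -(to_germK x). Qed.

Lemma eq_to_germ f g : (forall n, f n = g n) -> to_germ f = to_germ g.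
Proof. by move=> fg; apply/to_germP; exists 0 => n _. Qed.

Lemma germ_mulA : associative germ_mul.
Proof.
elim/germ_ind=> f; elim/germ_ind=> g; elim/germ_ind=> h.
by rewrite !germ_mulE; apply: eq_to_germ => n; rewrite mulgA.
Qed.

Lemma germ_mul1g : left_id germ_one germ_mul.
Proof. by elim/germ_ind=> f; rewrite germ_mulE; apply: eq_to_germ => n; rewrite mul1g. Qed.

Lemma germ_mulg1 : right_id germ_one germ_mul.
Proof. by elim/germ_ind=> f; rewrite germ_mulE; apply: eq_to_germ => n; rewrite mulg1. Qed.

Lemma germ_mulVg : left_inverse germ_one germ_inv germ_mul.
Proof.
by elim/germ_ind=> f; rewrite germ_invE germ_mulE; apply: eq_to_germ => n; rewrite mulVg.
Qed.

Lemma germ_mulgV : right_inverse germ_one germ_inv germ_mul.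
Proof.
by elim/germ_ind=> f; rewrite germ_invE germ_mulE; apply: eq_to_germ => n; rewrite mulgV.
Qed.

HB.instance Definition _ :=
  isGroup.Build germ germ_mulA germ_mul1g germ_mulg1 germ_mulVg germ_mulgV.

Lemma to_germ1 : to_germ (fun=> 1%g) = 1%g. Proof. by []. Qed.

Lemma to_germM f g : to_germ (fun n => f n * g n)%g = (to_germ f * to_germ g)%g.
Proof. by rewrite [RHS]germ_mulE. Qed.

Lemma to_germV f : to_germ (fun n => (f n)^-1)%g = ((to_germ f)^-1)%g.
Proof. by rewrite [RHS]germ_invE. Qed.

Lemma to_germX f m : to_germ (fun n => f n ^+ m)%g = (to_germ f ^+ m)%g.
Proof.
elim: m => [|m IHm]; first exact: to_germ1.
by rewrite expgS -IHm -to_germM; apply: eq_to_germ => n; rewrite expgS.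
Qed.

Lemma word_eval_germ w f g :
  word_eval w (to_germ f) (to_germ g) = to_germ (fun n => word_eval w (f n) (g n)).
Proof.
elim: w => [|c w IHw].
  by rewrite /word_eval big_nil -to_germ1; apply: eq_to_germ => n; rewrite big_nil.
rewrite /word_eval big_cons -/(word_eval w _ _) IHw.
transitivity (to_germ (fun n => (if c is LX then f n else g n) * word_eval w (f n) (g n))%g).
  by rewrite to_germM; case: c.
by apply: eq_to_germ => n; rewrite /word_eval big_cons.
Qed.

(** If m is prime to the exponent e n of T n, then x |-> x ^ m is inverted on T n by
x |-> x ^ k, where k is a Bezout coefficient with k m = 1 modulo e n.  It is
enough that this happens for all large n. *)
Lemma germ_uniquely_divisible (e : nat -> nat) :
  (forall n (x : T n), x ^+ e n = 1)%g ->
  (forall m, 0 < m -> eventually (fun n => coprime m (e n))) ->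
  uniquely_divisible germ.
Proof.
move=> expT co_e x m m_gt0; elim/germ_ind: x => g.
have [N coN] := co_e m m_gt0.
pose k n := (egcdn m (e n)).1.
have rootK n (y : T n) : N <= n -> (y ^+ (m * k n) = y)%g.
  move=> /coN co_n; rewrite /k; case: egcdnP => // a b Dab _ /=.
  by rewrite mulnC Dab (eqP co_n) expgD mulnC expgM expT expg1n mul1g expg1.
exists (to_germ (fun n => g n ^+ k n)%g); split.
  by rewrite -to_germX; apply/to_germP; exists N => n leNn; rewrite -expgM mulnC rootK.
elim/germ_ind=> h; rewrite -to_germX => /to_germP hg.
have geN : eventually (fun n => N <= n) by exists N.
apply/to_germP; apply: eventually_mono (eventually_and hg geN) => n [<- leNn].
by rewrite -expgM rootK.
Qed.

(** A commutator of germs is the germ of a sequence of commutators.  Taking for Q n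
a set closed under the group operations, rather than the commutator subgroup
of T n itself, spares a description of the latter. *)
Lemma germ_metabelian (Q : forall n, T n -> Prop) :
  (forall n x y, Q n [~ x, y]%g) -> (forall n x y, Q n x -> Q n y -> Q n (x * y)%g) ->
  (forall n x, Q n x -> Q n (x^-1)%g) -> (forall n x y, Q n x -> Q n y -> commute x y) ->
  metabelian germ.
Proof.
move=> QR QM QV Qc.
have commG (x : germ) : commutator_subgroup x ->
    exists2 f, x = to_germ f & forall n, Q n (f n).
  elim=> {x} [x y | | x y _ [f -> Qf] _ [g -> Qg] | x _ [f -> Qf]].
  - elim/germ_ind: x => f; elim/germ_ind: y => g; exists (fun n => [~ f n, g n]%g) => //.
    transitivity (to_germ (fun n => (f n)^-1 * ((g n)^-1 * (f n * g n)))%g).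
      by rewrite !to_germM !to_germV commgEl conjgE.
    by apply: eq_to_germ => n; rewrite commgEl conjgE.
  - exists (fun n => 1%g) => // n; rewrite -(commgg 1%g); exact: QR.
  - by exists (fun n => f n * g n)%g; rewrite ?to_germM // => n; apply: QM.
  by exists (fun n => (f n)^-1)%g; rewrite ?to_germV // => n; apply: QV.
move=> x y /commG[f -> Qf] /commG[g -> Qg].
by rewrite /commute -!to_germM; apply: eq_to_germ => n; apply: Qc.
Qed.
End ReducedProduct.

Local Open Scope ring_scope.

(** * Cyclotomic polynomials and their binary forms *)

(** The sum is (X^N - 1) / (X^d - 1), and Phi_N divides X^N - 1 but is not among the
cyclotomic factors of X^d - 1.  Two consequences are drawn below: a root of
Phi_N has order exactly N in any field where N is not 0, and Phi_N(1) divides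
N / d. *)
Lemma Cyclotomic_dvd_geometric N d : (d %| N)%N -> (d < N)%N ->
  exists R : {poly int}, \sum_(j < N %/ d) 'X^d ^+ j = 'Phi_N * R.
Proof.
move=> dN ltdN; have N_gt0: (0 < N)%N by apply: leq_ltn_trans ltdN.
have d_gt0 : (0 < d)%N by apply: dvdn_gt0 dN.
have := prod_Cyclotomic N_gt0; rewrite (bigID (fun e => e %| d)%N) /=.
have -> : \prod_(e <- divisors N | (e %| d)%N) 'Phi_e = 'X^d - 1.
  rewrite -prod_Cyclotomic // -big_filter; apply: perm_big.
  apply: uniq_perm; rewrite ?filter_uniq ?divisors_uniq // => e.
  rewrite mem_filter -!dvdn_divisors //.
  by case ed: (e %| d)%N => //=; rewrite (dvdn_trans ed dN).
rewrite (big_rem N) ?divisors_id //= gtnNdvd //=.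
set R := \prod_(_ <- _ | _) _ => eqR.
exists R; apply: (@mulfI _ ('X^d - 1)); first by rewrite monic_neq0 ?monicXnsubC.
by rewrite eqR -subrX1 -exprM mulnC divnK.
Qed.

(** The homogenization of f, of degree the degree of f. *)
Definition binary_form (S : comNzRingType) (f : {poly int}) (u v : S) : S :=
  \sum_(j < size f) (f`_j)%:~R * u ^+ j * v ^+ ((size f).-1 - j).

Lemma rmorph_binary_form (S T : comNzRingType) (h : {rmorphism S -> T}) f u v :
  h (binary_form f u v) = binary_form f (h u) (h v).
Proof.
rewrite rmorph_sum; apply: eq_bigr => j _.
by rewrite !rmorphM !rmorphXn rmorph_int.
Qed.

Lemma horner_binary_form (S : comNzRingType) f (p q : {poly S}) x :
  (binary_form f p q).[x] = binary_form f p.[x] q.[x].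
Proof. exact: (rmorph_binary_form (horner_eval x)). Qed.

Lemma binary_form_diag (S : comNzRingType) (f : {poly int}) (u : S) :
  binary_form f u u = f.[1]%:~R * u ^+ (size f).-1.
Proof.
rewrite horner_coef rmorph_sum mulr_suml; apply: eq_bigr => j _.
rewrite -mulrA -exprD expr1n mulr1; congr (_ * _ ^+ _).
by rewrite subnKC // -ltnS; case: (size f) j => [[]|].
Qed.

Lemma binary_formE (F : fieldType) (f : {poly int}) (u v : F) : v != 0 ->
  binary_form f u v = v ^+ (size f).-1 * (map_poly intr f).[u / v].
Proof.
move=> v0; rewrite (horner_coef_wide _ (size_poly _ _)) mulr_sumr.
apply: eq_bigr => j _; rewrite coef_map.
rewrite expr_div_n exprB ?unitfE //; last by rewrite -ltnS; case: (size f) j => [[]|].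
by rewrite [RHS]mulrCA -!mulrA; congr (_ * _); rewrite mulrCA.
Qed.

(** A Gaussian integer g(bi) is congruent to g(0) modulo b.  The integers v and w do
not depend on the ring: the sign of the value can be read in the complex
numbers, and its divisibility by p in a field of characteristic p. *)
Lemma Gaussian_eval (g : {poly int}) (b : int) :
  exists v w : int, forall (S : comNzRingType) (i : S), i ^+ 2 = -1 ->
    (map_poly intr g).[b%:~R * i] = (g`_0 + b * v)%:~R + (b * w)%:~R * i.
Proof.
suff H (f : {poly int}) : exists v w : int,
    forall (S : comNzRingType) (i : S), i ^+ 2 = -1 ->
    (map_poly intr f).[b%:~R * i] = v%:~R + w%:~R * i.
  elim/poly_ind: g => [|k c _].
    by exists 0, 0 => S i _; rewrite rmorph0 horner0 coef0 !mulr0 addr0 mul0r addr0.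
  have [v [w E]] := H k; exists (- w), v => S i i2.
  rewrite rmorphD rmorphM /= map_polyX map_polyC hornerMXaddC (E _ _ i2).
  rewrite coefD coefMX coefC /= add0r.
  by rewrite !(rmorphB, rmorphD, rmorphM, rmorphN) /=; ring: i2.
elim/poly_ind: f => [|k c [v [w E]]].
  by exists 0, 0 => S i _; rewrite rmorph0 horner0 mul0r addr0.
exists (c - b * w), (b * v) => S i i2.
rewrite rmorphD rmorphM /= map_polyX map_polyC hornerMXaddC (E _ _ i2).
by rewrite !(rmorphB, rmorphD, rmorphM, rmorphN) /=; ring: i2.
Qed.

(** * Fractions that make a split polynomial negative *)

Lemma real_seq_max (R : numDomainType) (x : R) (s : seq R) :
  {subset x :: s <= Num.real} -> exists2 m, m \in x :: s & {in x :: s, forall y, y <= m}.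
Proof.
elim: s x => [|y s IHs] x real_s.
  by exists x; rewrite ?mem_head // => y; rewrite inE => /eqP->.
have [|m ms max_m] := IHs y; first by move=> z zs; apply: real_s; rewrite inE zs orbT.
have realP z : z \in [:: x, y & s] -> z \is Num.real by exact: real_s.
have real_m : m \is Num.real by apply: realP; rewrite inE ms orbT.
have /orP[le_xm | le_mx] := real_leVge (realP _ (mem_head _ _)) real_m.
  exists m; first by rewrite inE ms orbT.
  by move=> z; rewrite inE => /orP[/eqP-> | /max_m].
exists x; first exact: mem_head.
by move=> z; rewrite inE => /orP[/eqP-> | /max_m /le_trans->].
Qed.

(** Between the two largest roots exactly one factor is negative.  The ordering of R
is partial, hence the reality hypotheses. *)
Lemma prod_neg_interval (R : numFieldType) (s : seq R) :
  {subset s <= Num.real} -> uniq s -> s != [::] ->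
  exists l m : R, [/\ l \is Num.real, m \is Num.real, l < m &
    forall x, l < x -> x < m -> \prod_(r <- s) (x - r) < 0].
Proof.
case: s => [|x s] // real_s uniq_s _.
have [m ms max_m] := real_seq_max real_s.
have real_m := real_s m ms.
pose s' := rem m (x :: s).
have s'P z : z \in s' -> z \in x :: s by apply: mem_rem.
have [l [real_l lt_lm max_l]] : exists l,
    [/\ l \is Num.real, l < m & {in s', forall y, y <= l}].
  case Ds': s' => [|y t].
    by exists (m - 1); rewrite realB ?real1 // gtrBl ltr01.
  have [|l ls max_l] := @real_seq_max R y t.
    by rewrite -Ds' => z /s'P /real_s.
  rewrite -Ds' in ls max_l *; exists l; split=> //; first by apply: real_s; apply: s'P.
  rewrite lt_neqAle max_m ?s'P // andbT.
  by move: ls; rewrite mem_rem_uniq // inE => /andP[].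
exists l, m; split=> // z lt_lz lt_zm.
rewrite (big_rem m) //= pmulr_llt0 ?subr_lt0 // big_seq.
by apply: prodr_gt0 => r /max_l le_rl; rewrite subr_gt0 (le_lt_trans le_rl).
Qed.

(** Fractions of this form are in lowest terms, and a form evaluated at such a
numerator and denominator is known modulo M. *)
Lemma coprime_ratio_dense (R : archiNumFieldType) (l m : R) (M : nat) :
  l \is Num.real -> m \is Num.real -> l < m -> (1 < M)%N ->
  exists (u : int) (k : nat), let x := (1 + M%:Z * u)%:~R / (M ^ k.+1)%:R in
    l < x /\ x < m.
Proof.
move=> real_l real_m lt_lm M_gt1.
have d_gt0 : 0 < m - l by rewrite subr_gt0.
have M_gt0 : 0 < M%:R :> R by rewrite ltr0n ltnW.
pose k := Num.truncn (m - l)^-1; pose b : R := (M ^ k.+1)%:R.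
have b_gt0 : 0 < b by rewrite ltr0n expn_gt0 ltnW.
(* An interval longer than M contains an integer equal to 1 modulo M. *)
have wide : M%:R < (m - l) * b.
  rewrite /b expnSr natrM mulrA ltr_pMl // mulrC -ltr_pdivrMr // div1r.
  have /truncn_itv/andP[_ /lt_le_trans] : 0 <= (m - l)^-1 by rewrite invr_ge0 ltW.
  by apply; rewrite ler_nat -/k ltn_expl.
have real_q : (l * b - 1) / M%:R \is Num.real.
  by rewrite !(realM, realB, real1, realV, realn).
exists (Num.floor ((l * b - 1) / M%:R) + 1), k; rewrite -/b /=; split.
  rewrite ltr_pdivlMr // rmorphD rmorphM /= rmorph1 -ltrBlDl [M%:~R * _]mulrC -ltr_pdivrMr //.
  exact: real_floorD1_gt.
rewrite ltr_pdivrMr // rmorphD rmorphM /= rmorph1 -ltrBrDl [M%:~R * _]mulrC.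
apply: le_lt_trans (_ : l * b - 1 + M%:R < _).
  rewrite rmorphD /= rmorph1 mulrDl mul1r lerD2r -ler_pdivlMr //.
  exact: real_floor_le.
by rewrite ltrBrDl addrA addrCA subrr addr0 -ltrBrDl -mulrBl.
Qed.

(** * Primes congruent to -1 modulo N *)

(** A product of odd numbers that are not 3 modulo 4 is 1 modulo 4. *)
Lemma prime_dvd_3mod4 n : (n %% 4 = 3)%N ->
  exists p, [/\ prime p, (p %| n)%N & (p %% 4 = 3)%N].
Proof.
elim/ltn_ind: n => n IHn n3.
have n_gt1 : (1 < n)%N by case: n n3 {IHn} => [|[]].
have [p3 | p3] := eqVneq (pdiv n %% 4)%N 3.
  by exists (pdiv n); rewrite pdiv_prime ?pdiv_dvd.
have /dvdnP[m Dn] := pdiv_dvd n; have p_pr := pdiv_prime n_gt1.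
have p_gt1 := prime_gt1 p_pr.
have m_gt0 : (0 < m)%N by case: m Dn => // Dn; rewrite Dn in n_gt1.
have [] := IHn m.
- by rewrite Dn ltn_Pmulr.
- move: n3 p3; rewrite {1}Dn -modnMm.
  have := ltn_pmod m (isT : (0 < 4)%N); have := ltn_pmod (pdiv n) (isT : (0 < 4)%N).
  by case: (m %% 4)%N => [|[|[|[|]]]] //; case: (pdiv n %% 4)%N => [|[|[|[|]]]].
by move=> q [q_pr qm q3]; exists q; rewrite Dn dvdn_mulr.
Qed.

(** As p = 3 modulo 4, the Frobenius maps i to -i and exchanges the two arguments of
the form.  Their quotient x therefore has x ^ (p + 1) = 1, and it is a root of
Phi_N, hence of order N because N is not 0 in L. *)
Lemma dvdn_Frobenius_order (L : fieldType) p N (i : L) (a b : int) :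
  p \in [pchar L] -> (p %% 4 = 3)%N -> i ^+ 2 = -1 ->
  N%:R != 0 :> L -> b%:~R != 0 :> L ->
  binary_form 'Phi_N (a%:~R + b%:~R * i) (a%:~R - b%:~R * i) = 0 ->
  (N %| p.+1)%N.
Proof.
move=> charL p3 i2 nzN nzb; set al := _ + _; set be := _ - _ => Phi0.
have p_pr := pcharf_prime charL.
have i_p : i ^+ p = - i.
  rewrite (divn_eq p 4) p3 mulnC exprD exprM [i ^+ 4](exprM i 2 2) i2 sqrrN !expr1n.
  by rewrite mul1r exprS i2 mulrN1.
have al_p : al ^+ p = be.
  rewrite -(pFrobenius_autE charL) pFrobenius_autD_comm; last exact: mulrC.
  rewrite pFrobenius_autM_comm; last exact: mulrC.
  by rewrite !pFrobenius_aut_int pFrobenius_autE i_p mulrN.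
have be_p : be ^+ p = al.
  rewrite -(pFrobenius_autE charL) pFrobenius_autB_comm; last exact: mulrC.
  rewrite pFrobenius_autM_comm; last exact: mulrC.
  by rewrite !pFrobenius_aut_int pFrobenius_autE i_p mulrN opprK.
have nz2 : 2%:R != 0 :> L.
  rewrite -(dvdn_pcharf charL) gtnNdvd //.
  by case: p p3 {charL p_pr i_p al_p be_p} => [|[|[|]]].
have nzi : i != 0 by rewrite -sqrf_eq0 i2 oppr_eq0 oner_eq0.
(* If one of the conjugates vanished, so would the other and 2bi. *)
have nzbe : be != 0.
  apply: contraTneq nz2 => be0; rewrite negbK.
  have al0 : al = 0 by rewrite -be_p be0 expr0n; case: p p_pr {p3 charL i_p al_p be_p}.
  have : 2%:R * b%:~R * i = 0 by rewrite -[RHS](subrr 0) -{1}al0 -be0 /al /be; ring.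
  by move/eqP; rewrite !mulf_eq0 (negPf nzb) (negPf nzi) !orbF.
pose x := al / be.
have nzal : al != 0 by rewrite -be_p expf_neq0.
have x_p1 : x ^+ p.+1 = 1.
  by rewrite exprS expr_div_n al_p be_p /x; field; rewrite nzal nzbe.
move: Phi0; rewrite (binary_formE _ _ nzbe) => /eqP.
rewrite mulf_eq0 expf_eq0 (negPf nzbe) andbF /=.
rewrite -/x => /eqP Phi0.
have PhiR (f : {poly int}) : (map_poly intr ('Phi_N * f)).[x] = 0.
  by rewrite rmorphM hornerM Phi0 mul0r.
have N_gt0 : (0 < N)%N by case: N nzN {Phi0 PhiR} => //; rewrite eqxx.
(* Otherwise x ^ d = 1 for a proper divisor d of N, and the geometric sum of
   [Cyclotomic_dvd_geometric] takes at x the value 0 and the value N / d. *)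
rewrite -[N in (N %| _)%N](_ : gcdn N p.+1 = N) ?dvdn_gcdr //.
have dvdN := dvdn_gcdl N p.+1; set d := gcdn N p.+1 in dvdN *.
apply/eqP; apply: contraNT nzN => neq_dN.
have lt_dN : (d < N)%N by rewrite ltn_neqAle neq_dN dvdn_leq.
have x_d : x ^+ d = 1.
  have [m1 m2 Dm _] := egcdnP p.+1 N_gt0.
  have x_N : x ^+ N = 1.
    have := prod_Cyclotomic N_gt0; rewrite (big_rem N) ?divisors_id //= => DXn.
    have := PhiR (\prod_(e <- rem N (divisors N)) 'Phi_e).
    rewrite DXn rmorphB rmorph1 rmorphXn /= map_polyX !hornerE => /eqP.
    by rewrite subr_eq0 => /eqP.
  have : x ^+ (m1 * N) = x ^+ (m2 * p.+1 + d) by rewrite Dm.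
  by rewrite exprD mulnC exprM x_N expr1n mulnC exprM x_p1 expr1n mul1r.
have [R DR] := Cyclotomic_dvd_geometric dvdN lt_dN.
have := PhiR R; rewrite -DR rmorph_sum horner_sum.
under eq_bigr => j _ do rewrite !rmorphXn /= map_polyX !hornerE x_d expr1n.
rewrite sumr_const card_ord => Nd0.
by rewrite -(divnK dvdN) natrM Nd0 mul0r.
Qed.

(** The form is the product of the a + bi - c (a - bi) over the primitive N-th roots
of unity c.  Each factor is (1 - c) (a - b r) with r = - i (1 + c) / (1 - c),
a cotangent: it is real because the conjugate of c is its inverse. *)
Lemma cyclotomic_form_real_roots N : (1 < N)%N ->
  exists s : seq algC, [/\ uniq s, s != [::], {subset s <= Num.real} &
    forall a b, a - b * 'i != 0 ->
      binary_form 'Phi_N (a + b * 'i) (a - b * 'i) =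
      ('Phi_N).[1]%:~R * \prod_(r <- s) (a - b * r)].
Proof.
move=> N_gt1; have N_gt0 := ltnW N_gt1.
have [z prim_z] := C_prim_root_exists N_gt0.
pose cs := [seq z ^+ k | k : 'I_N <- enum 'I_N & coprime k N].
have PhiE : map_poly (intr : int -> algC) 'Phi_N = \prod_(c <- cs) ('X - c%:P).
  by rewrite (Cintr_Cyclotomic prim_z) big_map big_filter big_enum_cond.
have cs_uniq : uniq cs.
  rewrite map_inj_in_uniq ?filter_uniq -?enumT ?enum_uniq // => j k _ _ /eqP.
  by rewrite (eq_prim_root_expr prim_z) !modn_small // => /eqP/val_inj.
have csP c : c \in cs -> [/\ c ^* = c^-1, c != 0 & 1 - c != 0].
  case/mapP => k; rewrite mem_filter => /andP[co_kN _] ->.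
  have prim_k : N.-primitive_root (z ^+ k) by rewrite prim_root_exp_coprime.
  have zk_N := prim_expr_order prim_k.
  have nz_zk : z ^+ k != 0.
    by apply: contraNneq (oner_neq0 algC) => zk0; rewrite -zk_N zk0 expr0n gtn_eqF.
  split=> //.
    have nrm1 : `|z ^+ k| = 1.
      by apply/eqP; rewrite -(eqrXn2 N_gt0) // -normrX zk_N normr1 expr1n.
    by have := invC_norm (z ^+ k); rewrite nrm1 expr1n invr1 mul1r.
  rewrite subr_eq0 eq_sym -(prim_order_dvd prim_k 1).
  by rewrite dvdn1 gtn_eqF.
pose cot (c : algC) : algC := - 'i * (1 + c) / (1 - c).
have nzi : 'i != 0 :> algC by rewrite neq0Ci.
exists (map cot cs); split.
- rewrite map_inj_in_uniq // => c d /csP[_ _ nz1c] /csP[_ _ nz1d] /eqP.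
  rewrite /cot -!mulrA (inj_eq (mulfI _)) ?oppr_eq0 // eqr_div // => /eqP E.
  have /eqP : 2%:R * (c - d) = 0.
    by rewrite -(subrr ((1 + c) * (1 - d))) {2}E; ring.
  by rewrite mulf_eq0 pnatr_eq0 /= subr_eq0 => /eqP.
- rewrite -size_eq0 size_map -lt0n.
  have := size_Cyclotomic N; rewrite -(size_map_inj_poly (@intr_inj algC)) //.
  by rewrite PhiE size_prod_XsubC => -[->]; rewrite totient_gt0.
- move=> _ /mapP[c /csP[conj_c nzc nz1c] ->].
  rewrite CrealE /cot !rmorphM rmorphV ?unitfE // rmorphN rmorphB rmorphD rmorph1.
  rewrite /= conj_c conjCi.
  have nzc1 : c - 1 != 0 by rewrite -opprB oppr_eq0.
  by apply/eqP; field; rewrite nz1c nzc nzc1.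
move=> a b nz_be; rewrite binary_formE // PhiE.
have -> : (size 'Phi_N).-1 = size cs.
  by rewrite -(size_map_inj_poly (@intr_inj algC)) // PhiE size_prod_XsubC.
have -> : ('Phi_N).[1]%:~R = \prod_(c <- cs) (1 - c).
  rewrite -horner_map /= rmorph1 PhiE horner_prod.
  by apply: eq_bigr => c _; rewrite !hornerE.
rewrite big_map horner_prod.
have -> y : y ^+ size cs = \prod_(c <- cs) y :> algC.
  by rewrite big_const_seq count_predT iter_mulr_1.
rewrite -!big_split; apply: eq_big_seq => c /csP[_ _ nz1c].
by rewrite hornerXsubC /cot /=; field; rewrite nz_be nz1c.
Qed.

(** By [Cyclotomic_dvd_geometric], Phi_N(1) divides both 2 and 3. *)
Lemma Cyclotomic1_unit N : (6 %| N)%N -> (0 < N)%N -> ('Phi_N).[1] ^+ 2 = 1.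
Proof.
move=> N6 N_gt0.
have dvd_q q : (1 < q)%N -> (q %| N)%N -> (('Phi_N).[1] %| q%:Z)%Z.
  move=> q_gt1 qN; have q_gt0 := ltnW q_gt1.
  have [||R DR] := @Cyclotomic_dvd_geometric N (N %/ q).
  - by apply/dvdnP; exists q; rewrite mulnC divnK.
  - by rewrite ltn_Pdiv.
  have /(congr1 (horner^~ 1)) := DR.
  rewrite hornerM horner_sum divnA // mulKn //.
  under eq_bigr => j _ do rewrite -exprM hornerXn expr1n.
  rewrite sumr_const card_ord natz => ->.
  exact: dvdz_mulr.
have : (('Phi_N).[1] %| 3%:Z - 2%:Z)%Z.
  by apply: rpredB; apply: dvd_q => //; apply: dvdn_trans N6.
by rewrite dvdz1 => /eqP u1; rewrite -real_normK ?num_real // -abszE u1.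
Qed.

(** A case of the theorem of Dirichlet on arithmetic progressions that has a
Euclidean proof: every prime p = 3 modulo 4 that divides the integer U
constructed below is -1 modulo N and exceeds m. *)
Theorem primes_congr_pred1 N m : (0 < N)%N ->
  exists p, [/\ prime p, (m < p)%N & (N %| p.+1)%N].
Proof.
wlog N12 : N / (12 %| N)%N => [IH N_gt0 | N_gt0].
  have [||p [p_pr ltmp dvdNp]] := IH (12 * N)%N; rewrite ?dvdn_mulr ?muln_gt0 //.
  by exists p; split=> //; apply: dvdn_trans dvdNp; apply: dvdn_mull.
have N_gt1 : (1 < N)%N by apply: leq_trans (dvdn_leq N_gt0 N12).
(* The factor m! keeps the primes up to m out of U, which is 1 modulo M. *)
pose M := (N * m`!)%N; have M_gt1 : (1 < M)%N.
  by rewrite (leq_trans N_gt1) // leq_pmulr // fact_gt0.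
have [s [s_uniq s_n0 s_real PhiE]] := cyclotomic_form_real_roots N_gt1.
have [l [h [l_real h_real lt_lh neg_s]]] := prod_neg_interval s_real s_uniq s_n0.
have [u [k [ltl lth]]] := coprime_ratio_dense l_real h_real lt_lh M_gt1.
pose a : int := 1 + M%:Z * u; pose b : int := (M ^ k.+1)%N.
rewrite -/a in ltl lth.
(* g(bi) is the cyclotomic form at a + bi and a - bi, for every choice of i. *)
pose g : {poly int} := binary_form 'Phi_N (a%:P + 'X) (a%:P - 'X).
have gE (S : comNzRingType) (i : S) : (map_poly intr g).[b%:~R * i] =
    binary_form 'Phi_N (a%:~R + b%:~R * i) (a%:~R - b%:~R * i).
  rewrite (rmorph_binary_form (map_poly intr)) horner_binary_form.
  by rewrite rmorphD rmorphB /= map_polyX map_polyC !hornerE.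
have g0E : g`_0 = ('Phi_N).[1] * a ^+ totient N.
  rewrite -horner_coef0 horner_binary_form !hornerE ?subr0.
  by rewrite binary_form_diag size_Cyclotomic intz.
have [v [w gauss]] := Gaussian_eval g b.
pose V := g`_0 + b * v.
have b_gt0 : 0 < b by rewrite ltz_nat expn_gt0 ltnW.
have nzb : b%:~R != 0 :> algC by rewrite intr_eq0 gt_eqF.
pose U := ('Phi_N).[1] * V.
have eps2 : ('Phi_N).[1] ^+ 2 = 1 by apply: Cyclotomic1_unit; rewrite // (dvdn_trans _ N12).
(* The factors a - b r are real, so the value of the form has no imaginary part. *)
have [bw0 Vreal] : b * w = 0 /\
    V%:~R = ('Phi_N).[1]%:~R * \prod_(r <- s) (a%:~R - b%:~R * r) :> algC.
  have := gauss _ _ (sqrCi algC); rewrite gE PhiE; last first.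
    rewrite subr_eq0; apply/eqP => /(congr1 (fun z => 'Im z)) /eqP.
    by rewrite ImMl ?rpred_int // Im_i mulr1 (Creal_ImP _ _) ?rpred_int // eq_sym (negPf nzb).
  set X := (X in X = _); rewrite [_ * 'i]mulrC => E.
  have realX : X \is Num.real.
    rewrite rpredM ?rpred_int // big_seq rpred_prod // => r /s_real real_r.
    by rewrite rpredB ?rpredM ?rpred_int.
  have := congr1 (fun z => 'Im z) E; have := congr1 (fun z => 'Re z) E.
  rewrite Re_rect ?Im_rect ?rpred_int // (Creal_ReP _ realX) (Creal_ImP _ realX) => DX /esym/eqP.
  by rewrite intr_eq0 => /eqP bw0; split; last exact: esym DX.
(* U is the product of the a - b r, as Phi_N(1)^2 = 1. *)
have U_lt0 : U < 0.
  rewrite -(ltrz0 algC) intrM Vreal mulrA -intrM -expr2 eps2 mul1r.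
  have -> : \prod_(r <- s) (a%:~R - b%:~R * r) =
      b%:~R ^+ size s * \prod_(r <- s) (a%:~R / b%:~R - r) :> algC.
    have -> : b%:~R ^+ size s = \prod_(r <- s) b%:~R :> algC.
      by rewrite big_const_seq count_predT iter_mulr_1.
    by rewrite -big_split; apply: eq_bigr => r _ /=; field.
  by rewrite pmulr_rlt0 ?exprn_gt0 ?ltr0z ?neg_s.
pose n := `|U|%N.
have DU : U = - n%:Z by rewrite /n; lia.
have dvdM : (M %| n.+1)%N.
  have : (M%:Z %| 1 - U)%Z.
    rewrite /U /V g0E mulrDr mulrA -expr2 eps2 mul1r opprD addrA rpredB //.
      rewrite -opprB rpredN subrX1 dvdz_mulr // /a addrC addKr.
      exact: dvdz_mulr.
    rewrite mulrCA dvdz_mulr // /b /dvdz /= expnS.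
    exact: dvdn_mulr.
  by rewrite DU opprK -PoszD add1n.
have M12 : (12 %| M)%N by rewrite dvdn_mulr.
have [|p [p_pr dvdpn p3]] := @prime_dvd_3mod4 n.
  have : (4 %| n.+1)%N by apply: dvdn_trans dvdM; apply: dvdn_trans M12.
  by lia.
have pM : ~~ (p %| M)%N.
  apply/negP => /dvdn_trans/(_ dvdM); rewrite -addn1 dvdn_addr // dvdn1.
  by move=> /eqP p1; rewrite p1 in p_pr.
exists p; split=> //.
  rewrite ltnNge; apply: contra pM => le_pm.
  by rewrite dvdn_mull // dvdn_fact // prime_gt0.
have [L [f _]] := countable_algebraic_closure 'F_p.
have charL : p \in [pchar L] by apply: (rmorph_pchar f); apply: pchar_Fp.
(* i is a root of X^2 + 1, written as X^2 = (-1) + 0 X. *)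
have [i] := solve_monicpoly (fun k => if k == 0 then -1 else 0 : L) (isT : (0 < 2)%N).
rewrite !big_ord_recl big_ord0 expr0 mulr1 mul0r !addr0 => i2.
apply: (dvdn_Frobenius_order (a := a) (b := b) charL p3 i2).
- by rewrite -(dvdn_pcharf charL); apply: contra pM => pN; rewrite dvdn_mulr.
- rewrite -[_%:~R]/((M ^ k.+1)%:R) -(dvdn_pcharf charL) Euclid_dvdX //.
  by rewrite (negPf pM).
rewrite -gE (gauss _ _ i2) -/V.
have p0 (x : int) : (p%:Z %| x)%Z -> x%:~R = 0 :> L.
  by case/dvdzP=> y ->; rewrite intrM -(pmulrn 1 p) (pcharf0 charL) mulr0.
rewrite bw0 mul0r addr0 p0 // (_ : V = ('Phi_N).[1] * U).
  by rewrite dvdz_mull // DU rpredN.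
by rewrite /U mulrA -expr2 eps2 mul1r.
Qed.

(** * Affine groups with square linear parts *)

Definition nz_square (F : finFieldType) (h : F) : bool :=
  [exists s, (s != 0) && (h == s ^+ 2)].

(** The pair (h, v) stands for the affine map z |-> h z + v. *)
Definition sq_affine (F : finFieldType) : Type := {hv : F * F | nz_square hv.1}.
HB.instance Definition _ F := Choice.on (sq_affine F).

Section SquareAffine.
Variable F : finFieldType.
Implicit Types (x y z : sq_affine F) (s t v : F).

Lemma nz_squareP (h : F) : reflect (exists2 s, s != 0 & h = s ^+ 2) (nz_square h).
Proof.
apply: (iffP existsP) => [[s /andP[s0 /eqP]] | [s s0 ->]]; first by exists s.
by exists s; rewrite s0 eqxx.
Qed.

Lemma nz_square_neq0 (h : F) : nz_square h -> h != 0.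
Proof. by case/nz_squareP=> s s0 ->; rewrite expf_neq0. Qed.

Lemma nz_square1 : nz_square (1 : F).
Proof. by apply/nz_squareP; exists 1; rewrite ?oner_eq0 ?expr1n. Qed.

Lemma nz_squareM (g h : F) : nz_square g -> nz_square h -> nz_square (g * h).
Proof.
move=> /nz_squareP[s s0 ->] /nz_squareP[t t0 ->]; apply/nz_squareP.
by exists (s * t); rewrite ?mulf_neq0 ?exprMn.
Qed.

Lemma nz_squareV (h : F) : nz_square h -> nz_square h^-1.
Proof.
move=> /nz_squareP[s s0 ->]; apply/nz_squareP.
by exists s^-1; rewrite ?invr_eq0 ?exprVn.
Qed.

Definition lin x : F := (val x).1.
Definition shift x : F := (val x).2.

Lemma lin_square x : nz_square (lin x). Proof. exact: (valP x). Qed.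
Lemma lin_neq0 x : lin x != 0. Proof. exact/nz_square_neq0/lin_square. Qed.

Lemma sq_affine_eqP x y : x = y <-> lin x = lin y /\ shift x = shift y.
Proof.
split=> [-> // | [Dl Ds]]; apply: val_inj; move: Dl Ds; rewrite /lin /shift.
by case: (val x) (val y) => [? ?] [? ?] /= -> ->.
Qed.

Definition sq_affine_of h (sq_h : nz_square h) v : sq_affine F :=
  @exist (F * F) (fun hv => nz_square hv.1) (h, v) sq_h.

Definition sqa_one := sq_affine_of nz_square1 0.
Definition sqa_mul x y :=
  sq_affine_of (nz_squareM (lin_square x) (lin_square y)) (shift x + lin x * shift y).
Definition sqa_inv x :=
  sq_affine_of (nz_squareV (lin_square x)) (- (lin x)^-1 * shift x).

Let lin_mul x y : lin (sqa_mul x y) = lin x * lin y. Proof. by []. Qed.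
Let shift_mul x y : shift (sqa_mul x y) = shift x + lin x * shift y. Proof. by []. Qed.
Let lin_inv x : lin (sqa_inv x) = (lin x)^-1. Proof. by []. Qed.
Let shift_inv x : shift (sqa_inv x) = - (lin x)^-1 * shift x. Proof. by []. Qed.
Let lin_one : lin sqa_one = 1. Proof. by []. Qed.
Let shift_one : shift sqa_one = 0. Proof. by []. Qed.
Let sqaE := (lin_mul, shift_mul, lin_inv, shift_inv, lin_one, shift_one).

Lemma sqa_mulA : associative sqa_mul.
Proof. by move=> x y z; apply/sq_affine_eqP; rewrite !sqaE; split; ring. Qed.

Lemma sqa_mul1g : left_id sqa_one sqa_mul.
Proof. by move=> x; apply/sq_affine_eqP; rewrite !sqaE; split; ring. Qed.

Lemma sqa_mulg1 : right_id sqa_one sqa_mul.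
Proof. by move=> x; apply/sq_affine_eqP; rewrite !sqaE; split; ring. Qed.

Lemma sqa_mulVg : left_inverse sqa_one sqa_inv sqa_mul.
Proof.
move=> x; apply/sq_affine_eqP; have nz := lin_neq0 x; rewrite !sqaE.
by split; field.
Qed.

Lemma sqa_mulgV : right_inverse sqa_one sqa_inv sqa_mul.
Proof.
move=> x; apply/sq_affine_eqP; have nz := lin_neq0 x; rewrite !sqaE.
by split; field.
Qed.

HB.instance Definition _ :=
  isGroup.Build (sq_affine F) sqa_mulA sqa_mul1g sqa_mulg1 sqa_mulVg sqa_mulgV.

Lemma linM x y : lin (x * y)%g = lin x * lin y. Proof. by []. Qed.
Lemma shiftM x y : shift (x * y)%g = shift x + lin x * shift y. Proof. by []. Qed.
Lemma linV x : lin (x^-1)%g = (lin x)^-1. Proof. by []. Qed.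

Lemma linX x m : lin (x ^+ m)%g = lin x ^+ m.
Proof. by elim: m => // m IHm; rewrite expgS exprS -IHm. Qed.

Lemma shiftX1 x m : lin x = 1 -> shift (x ^+ m)%g = shift x *+ m.
Proof.
move=> x1; elim: m => // m IHm; rewrite expgS shiftM IHm x1 mul1r.
by rewrite mulrS.
Qed.

Lemma linR x y : lin [~ x, y]%g = 1.
Proof.
rewrite commgEl conjgE !linM !linV.
by have := lin_neq0 x; have := lin_neq0 y => ? ?; field; apply/andP.
Qed.

Lemma commute_lin1 x y : lin x = 1 -> lin y = 1 -> commute x y.
Proof.
by move=> x1 y1; apply/sq_affine_eqP; rewrite !linM !shiftM x1 y1; split; ring.
Qed.
End SquareAffine.

Section WordEval.
Variable F : finFieldType.

(** P_w over an arbitrary finite field and already evaluated, so that it can be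
computed by recursion on w. *)
Definition word_poly_at (w : word) (x y : F) : F :=
  let a := A_exponents w in
  \sum_(k < (size a).-1) x ^+ k * y ^+ (\sum_(i < k.+1) nth 0%N a i)%N.

Definition isX (c : letter) : bool := if c is LX then true else false.

Lemma size_A_exponents w : size (A_exponents w) = (count isX w).+1.
Proof.
elim: w => // -[] w IHw /=; first by rewrite IHw.
by rewrite size_incr_nth IHw.
Qed.

Lemma word_poly_at_X w x y : word_poly_at (LX :: w) x y = 1 + x * word_poly_at w x y.
Proof.
rewrite /word_poly_at /= size_A_exponents /= big_ord_recl big_ord1 /= mul1r expr0.
congr (_ + _); rewrite mulr_sumr; apply: eq_bigr => k _.
by rewrite big_ord_recl /= add0n exprS mulrA.
Qed.

Lemma word_poly_at_A w x y : word_poly_at (LA :: w) x y = y * word_poly_at w x y.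
Proof.
rewrite /word_poly_at /= size_incr_nth size_A_exponents /= mulr_sumr.
apply: eq_bigr => k _; rewrite mulrCA -exprS; congr (_ * _ ^+ _).
rewrite !big_ord_recl /= nth_incr_nth /= add1n addSn; congr (_ + _).+1%N.
by apply: eq_bigr => i _; rewrite nth_incr_nth.
Qed.

Lemma lin_word_eval w (X A : sq_affine F) :
  lin (word_eval w X A) = lin X ^+ count isX w * lin A ^+ count (predC isX) w.
Proof.
elim: w => [|c w IHw]; first by rewrite /word_eval big_nil mulr1.
rewrite /word_eval big_cons linM -/(word_eval w X A) IHw.
by case: c => /=; rewrite ?add0n ?add1n exprS; [rewrite mulrA | rewrite mulrCA].
Qed.

(** Each letter X contributes its translation t multiplied by the linear parts of the
letters on its left, which is the corresponding monomial of P_w times t; the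
letters A contribute no translation. *)
Lemma shift_word_eval w (X A : sq_affine F) : shift A = 0 ->
  shift (word_eval w X A) = shift X * word_poly_at w (lin X) (lin A).
Proof.
move=> A0; elim: w => [|c w IHw].
  by rewrite /word_eval big_nil /word_poly_at /= big_ord0 mulr0.
rewrite /word_eval big_cons shiftM -/(word_eval w X A) IHw.
by case: c; rewrite ?word_poly_at_X ?word_poly_at_A ?A0; ring.
Qed.
End WordEval.

Lemma word_poly_atE p w (x y : 'F_p) :
  (word_poly_Fp p w).[x, y] = word_poly_at w x y.
Proof.
rewrite /word_poly_Fp /word_poly rmorph_sum !horner_sum; apply: eq_bigr => k _.
rewrite rmorphM !rmorphXn /= map_polyX map_polyC /= map_polyX.
by rewrite !hornerE.
Qed.

(** A common prime factor q divides p + 1 and p - 1, so q = 2; but (p - 1) / 2 is odd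
since 4 divides p + 1. *)
Lemma half_pred_prime_coprime p n : prime p -> (4 * n`! %| p.+1)%N ->
  coprime n`! p.-1./2.
Proof.
move=> p_pr dvdp1; have p_gt0 := prime_gt0 p_pr.
have p3 : (4 %| p.+1)%N by apply: dvdn_trans dvdp1; apply: dvdn_mulr.
have {}dvdp1 : (n`! %| p.+1)%N by apply: dvdn_trans dvdp1; apply: dvdn_mull.
rewrite -[coprime _ _]negbK; apply/negP.
rewrite coprime_has_primes ?fact_gt0 //; last by lia.
rewrite negbK => /hasP[q]; rewrite !mem_primes => /and3P[q_pr _ qh] /= /and3P[_ _ qn].
have q2 : (q %| 2)%N.
  have -> : 2%N = (p.+1 - (p.-1)./2 * 2)%N by lia.
  by apply: dvdn_sub; [exact: dvdn_trans dvdp1 | exact: dvdn_mulr].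
move: q2; rewrite dvdn_prime2 // => /eqP Dq; subst q; lia.
Qed.

Lemma nz_square_half p (h : 'F_p) : prime p -> odd p -> nz_square h ->
  h ^+ p.-1./2 = 1.
Proof.
move=> p_pr odd_p /nz_squareP[s s0 ->].
rewrite -exprM; have -> : (2 * p.-1./2 = p.-1)%N by have := prime_gt0 p_pr; lia.
apply: (mulfI s0); rewrite -exprS prednK ?prime_gt0 // mulr1.
by have := expf_card s; rewrite card_Fp.
Qed.

(** The power (p - 1) / 2 of an affine map with square linear part is a translation,
whose p-th power is trivial. *)
Lemma sq_affine_exponent p (x : sq_affine 'F_p) : prime p -> odd p ->
  (x ^+ (p.-1./2 * p) = 1)%g.
Proof.
move=> p_pr odd_p; rewrite expgM; set y := (x ^+ _)%g.
have y1 : lin y = 1 by rewrite linX nz_square_half ?lin_square.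
apply/sq_affine_eqP; split; first by rewrite linX y1 expr1n.
by rewrite shiftX1 // -mulr_natr pchar_Fp_0 // mulr0.
Qed.

(** * The group and its word equations *)

Lemma exists_sparse_prime n : exists p, [&& prime p, (n < p)%N & (4 * n`! %| p.+1)%N].
Proof.
have [|p [p_pr ltnp dvdp]] := @primes_congr_pred1 (4 * n`!) n.
  by rewrite muln_gt0 fact_gt0.
by exists p; rewrite p_pr ltnp dvdp.
Qed.

Definition sparse_prime n : nat := xchoose (exists_sparse_prime n).

Lemma sparse_primeP n : [/\ prime (sparse_prime n), (n < sparse_prime n)%N &
  (4 * n`! %| (sparse_prime n).+1)%N].
Proof. exact/and3P/(xchooseP (exists_sparse_prime n)). Qed.

Definition sq_affine_limit : groupType := germ (fun n => sq_affine 'F_(sparse_prime n)).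

Lemma odd_sparse_prime n : odd (sparse_prime n).
Proof.
have [_ _ dvdp] := sparse_primeP n.
have : (4 %| (sparse_prime n).+1)%N by apply: dvdn_trans dvdp; apply: dvdn_mulr.
by lia.
Qed.

Lemma coprime_half_sparse_prime m n : (0 < m)%N -> (m <= n)%N ->
  coprime m ((sparse_prime n).-1)./2.
Proof.
move=> m_gt0 le_mn; have [p_pr _ dvdp] := sparse_primeP n.
by apply: coprime_dvdl (half_pred_prime_coprime p_pr dvdp); rewrite dvdn_fact ?m_gt0.
Qed.

Lemma sq_affine_limit_uniquely_divisible : uniquely_divisible sq_affine_limit.
Proof.
apply: (@germ_uniquely_divisible _ (fun n => (sparse_prime n).-1./2 * sparse_prime n)%N).
  move=> n x; have [p_pr _ _] := sparse_primeP n.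
  exact: sq_affine_exponent (odd_sparse_prime n).
move=> m m_gt0; exists m => n le_mn; rewrite coprimeMr coprime_half_sparse_prime //.
have [p_pr ltnp _] := sparse_primeP n.
by rewrite coprime_sym prime_coprime // gtnNdvd // (leq_ltn_trans le_mn).
Qed.

Lemma sq_affine_limit_metabelian : metabelian sq_affine_limit.
Proof.
apply: (@germ_metabelian _ (fun n x => lin x = 1)) => n x.
- exact: linR.
- by move=> y x1 y1; rewrite linM x1 y1 mul1r.
- by move=> x1; rewrite linV x1 invr1.
exact: commute_lin1.
Qed.

Lemma nz_square_exp_inj p m (g h : 'F_p) : prime p -> odd p -> coprime m p.-1./2 ->
  nz_square g -> nz_square h -> g ^+ m = h ^+ m -> g = h.
Proof.
move=> p_pr odd_p co_m sq_g sq_h eq_m.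
have h0 := nz_square_neq0 sq_h.
suff q1 : g / h = 1 by rewrite -[g](divfK h0) q1 mul1r.
have qm : (g / h) ^+ m = 1 by rewrite expr_div_n eq_m divff ?expf_neq0.
have qe : (g / h) ^+ p.-1./2 = 1 by rewrite nz_square_half ?nz_squareM ?nz_squareV.
have m_gt0 : (0 < p.-1./2)%N by have := prime_gt1 p_pr; move: odd_p; clear; lia.
have [a b Dab _] := egcdnP m m_gt0.
have : (g / h) ^+ (a * p.-1./2) = (g / h) ^+ (b * m + gcdn p.-1./2 m) by rewrite Dab.
by rewrite gcdnC (eqP co_m) exprD expr1 mulnC exprM qe mulnC exprM qm !expr1n mul1r.
Qed.

Theorem theorem1p1 :
  exists G : groupType,
    [/\ uniquely_divisible G, metabelian G &
        forall w : word,
          (exists E : seq nat, forall p : nat, prime p -> p \notin E ->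
             exists x y : 'F_p,
               [/\ x != 0, y != 0 & (word_poly_Fp p w).[x ^+ 2, y ^+ 2] = 0]) ->
          exists A B B' : G,
            (forall X : G, word_eval w X A <> B) /\
            (exists X1 X2 : G,
               [/\ X1 <> X2, word_eval w X1 A = B' & word_eval w X2 A = B'])].
Proof.
exists sq_affine_limit; split.
- exact: sq_affine_limit_uniquely_divisible.
- exact: sq_affine_limit_metabelian.
move=> w [E rootE].
(* Below the bound on E the value (1, 1) is a filler. *)
have roots n : exists gh : 'F_(sparse_prime n) * 'F_(sparse_prime n),
    [/\ nz_square gh.1, nz_square gh.2 &
        (\max_(p <- E) p <= n)%N -> word_poly_at w gh.1 gh.2 = 0].
  have [le_En | _] := leqP (\max_(p <- E) p) n; last first.
    by exists (1, 1); rewrite nz_square1.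
  have [p_pr ltnp _] := sparse_primeP n.
  have [|x [y [x0 y0 root_xy]]] := rootE _ p_pr.
    apply/negP => pE; have := leq_trans ltnp (leq_trans (leq_bigmax_seq _ pE isT) le_En).
    by rewrite ltnn.
  exists (x ^+ 2, y ^+ 2); split=> [||_].
  - by apply/nz_squareP; exists x.
  - by apply/nz_squareP; exists y.
  by rewrite -word_poly_atE.
have {roots}/(_ _)/cid rootsP n := roots n.
pose sq1 n : nz_square (projT1 (rootsP n)).1 := let: And3 h _ _ := projT2 (rootsP n) in h.
pose sq2 n : nz_square (projT1 (rootsP n)).2 := let: And3 _ h _ := projT2 (rootsP n) in h.
pose A n := sq_affine_of (sq2 n) 0; pose X t n := sq_affine_of (sq1 n) (t%:R).
have root_XA n : (\max_(p <- E) p <= n)%N -> word_poly_at w (lin (X 0%N n)) (lin (A n)) = 0.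
  by move=> leEn; have [_ _] := projT2 (rootsP n); apply.
pose W t n := word_eval w (X t n) (A n).
pose B n := sq_affine_of (lin_square (W 0%N n)) 1.
exists (to_germ A), (to_germ B), (to_germ (W 0%N)).
split.
  elim/germ_ind=> Y; rewrite word_eval_germ => /to_germP [N eqN].
  (* At this index the equation holds, the prime avoids E, and the number of
     letters X, unless it is 0, is prime to (p - 1) / 2. *)
  pose n := maxn N (maxn (\max_(p <- E) p) (count isX w)).
  have [p_pr _ _] := sparse_primeP n.
  have [leN leE leX] : [/\ (N <= n)%N, (\max_(p <- E) p <= n)%N & (count isX w <= n)%N].
    by rewrite /n !leq_max !leqnn !orbT.
  have /sq_affine_eqP[eq_lin eq_shift] := eqN n leN.
  rewrite shift_word_eval // in eq_shift.
  suff polyY : word_poly_at w (lin (Y n)) (lin (A n)) = 0.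
    by move/eqP: eq_shift; rewrite polyY mulr0 eq_sym oner_eq0.
  have [nX0 | nX_gt0] := posnP (count isX w).
    by rewrite /word_poly_at size_A_exponents nX0 big_ord0.
  rewrite -[RHS](root_XA n leE); congr (word_poly_at w _ _).
  apply: (nz_square_exp_inj p_pr (odd_sparse_prime n) (coprime_half_sparse_prime nX_gt0 leX));
    rewrite ?lin_square //.
  have nzA : lin (A n) ^+ count (predC isX) w != 0 by rewrite expf_neq0 ?lin_neq0.
  by apply: (mulIf nzA); rewrite -!lin_word_eval.
exists (to_germ (X 0%N)), (to_germ (X 1%N)); split.
- move=> /to_germP [N /(_ N (leqnn N)) /sq_affine_eqP[_ /eqP]].
  by rewrite eq_sym oner_eq0.
- by rewrite word_eval_germ.
rewrite word_eval_germ; apply/to_germP; exists (\max_(p <- E) p)%N => n leE.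
apply/sq_affine_eqP; split; first by rewrite !lin_word_eval.
by rewrite !shift_word_eval // [word_poly_at _ _ _]root_XA // !mulr0.
Qed.
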